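(* For each integer $n\geq 0$ and every $x\in\mathbb{C}$, \[ \sum_{k=0}^n \binom{n}{k} C_{2(n-k)}(x)\,\bigl(12x\sqrt{9x^2-1}\bigr)^{k} E_{k}(x) = \bigl( 18x^2 - 1 + 6x(2x-1)\sqrt{9x^2-1}\bigr)^{n}, \] where $\sqrt{9x^2-1}$ denotes a fixed square root of $9x^2-1$ (the same one on both sides).
   Context: Lucas-balancing polynomials $C_n(x)$ are defined by $C_0(x)=1$, $C_1(x)=3x$, $C_n(x)=6xC_{n-1}(x)-C_{n-2}(x)$ for $n\geq 2$. Euler polynomials $E_n(x)$ are defined by $\sum_{n\geq 0} E_n(x)\frac{z^n}{n!}=\frac{2e^{xz}}{e^z+1}$. *)

(* Defs.v *)
From HB Require Import structures.
From mathcomp Require Import all_boot all_order all_algebra.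
From mathcomp Require Import reals.
From mathcomp Require Export complex.

Set Implicit Arguments.
Unset Strict Implicit.
Unset Printing Implicit Defensive.

Import Order.TTheory GRing.Theory Num.Theory.
Local Open Scope ring_scope.

(* Formal power series in z over A, given by their coefficients: f stands for
   \sum_n f n * z ^ n. *)
Section FormalPowerSeries.
Context (A : comUnitRingType).

Definition fps := nat -> A.

Definition fps_one : fps := fun n => (n == 0%N)%:R.
Definition fps_add (f g : fps) : fps := fun n => f n + g n.
Definition fps_scale (a : A) (f : fps) : fps := fun n => a * f n.
Definition fps_mul (f g : fps) : fps :=
  fun n => \sum_(i < n.+1) f i * g (n - i)%N.

(* First n.+1 coefficients of 1 / g, for g with an invertible constant term. *)
Fixpoint fps_inv_coefs (g : fps) (n : nat) : seq A :=
  if n is m.+1 then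
    let s := fps_inv_coefs g m in
    rcons s (- ((g 0%N)^-1 * \sum_(i < m.+1) s`_i * g (m.+1 - i)%N))
  else [:: (g 0%N)^-1].

Definition fps_inv (g : fps) : fps := fun n => (fps_inv_coefs g n)`_n.
Definition fps_div (f g : fps) : fps := fps_mul f (fps_inv g).

(* e^(a z) *)
Definition fps_exp (a : A) : fps := fun n => a ^+ n / n`!%:R.

(* \sum_n u n * z ^ n / n! *)
Definition fps_egf (u : nat -> A) : fps := fun n => u n / n`!%:R.

Lemma size_fps_inv_coefs g n : size (fps_inv_coefs g n) = n.+1.
Proof. by elim: n => //= n IHn; rewrite size_rcons IHn. Qed.

Lemma nth_fps_inv_coefs g n i :
  (i <= n)%N -> (fps_inv_coefs g n)`_i = fps_inv g i.
Proof.
elim: n => [|n IHn]; first by rewrite leqn0 => /eqP ->.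
rewrite leq_eqVlt => /predU1P[-> //|lt_in] /=.
by rewrite nth_rcons size_fps_inv_coefs lt_in IHn.
Qed.

Lemma fps_mulVl g : g 0%N \is a GRing.unit ->
  fps_mul (fps_inv g) g =1 fps_one.
Proof.
move=> Ug [|n]; rewrite /fps_mul /fps_one.
  by rewrite big_ord_recl big_ord0 addr0 /fps_inv /= mulVr.
rewrite big_ord_recr /= subnn [fps_inv g n.+1]/fps_inv /= nth_rcons.
rewrite size_fps_inv_coefs ltnn eqxx mulNr mulrAC mulVr // mul1r.
apply/eqP; rewrite subr_eq0; apply/eqP; apply: eq_bigr => i _.
by rewrite nth_fps_inv_coefs // -ltnS.
Qed.

Lemma fps_mul1 f : fps_mul f fps_one =1 f.
Proof.
move=> n; rewrite /fps_mul big_ord_recr /= subnn mulr1 big1 ?add0r // => i _.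
by rewrite /fps_one subn_eq0 leqNgt ltn_ord mulr0.
Qed.

Lemma eq_fps_mul f f' g g' : f =1 f' -> g =1 g' -> fps_mul f g =1 fps_mul f' g'.
Proof. by move=> ff' gg' n; apply: eq_bigr => i _; rewrite ff' gg'. Qed.

(* Truncations to polynomials turn fps_mul into polynomial multiplication. *)
Lemma fps_mul_poly f g m n : (n < m)%N ->
  fps_mul f g n = (\poly_(i < m) f i * \poly_(i < m) g i)`_n.
Proof.
move=> lt_nm; rewrite coefM; apply: eq_bigr => -[i /= lt_in] _.
rewrite !coef_poly (leq_trans lt_in lt_nm).
by rewrite (leq_ltn_trans (leq_subr _ _) lt_nm).
Qed.

Lemma fps_mulA f g h : fps_mul f (fps_mul g h) =1 fps_mul (fps_mul f g) h.
Proof.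
move=> n; pose P u : {poly A} := \poly_(i < n.+1) u i.
transitivity ((P f * (P g * P h))`_n).
  rewrite coefM; apply: eq_bigr => i _.
  rewrite (@fps_mul_poly g h n.+1) ?ltnS ?leq_subr //.
  by rewrite coef_poly ltn_ord.
rewrite mulrA coefM; apply: eq_bigr => i _.
by rewrite (@fps_mul_poly f g n.+1) // coef_poly ltnS leq_subr.
Qed.

Lemma fps_divK f g : g 0%N \is a GRing.unit -> fps_mul (fps_div f g) g =1 f.
Proof.
move=> Ug n; rewrite -fps_mulA -[RHS]fps_mul1.
exact: eq_fps_mul (fps_mulVl Ug) n.
Qed.

End FormalPowerSeries.

Section Polynomials.
Context (F : numFieldType).

Fixpoint lucas_balancing (n : nat) : {poly F} :=
  match n with
  | 0 => 1
  | 1 => 3%:R *: 'X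
  | (m.+1 as k).+1 => 6%:R *: 'X * lucas_balancing k - lucas_balancing m
  end.

(* 2 e^(x z) / (e^z + 1) as a power series in z over F[x]. *)
Definition euler_gf : fps {poly F} :=
  fps_div (fps_scale 2%:R (fps_exp 'X)) (fps_add (fps_exp 1) (@fps_one _)).

Definition euler_poly (n : nat) : {poly F} := n`!%:R * euler_gf n.

Lemma unit_polyn n : (0 < n)%N -> (n%:R : {poly F}) \is a GRing.unit.
Proof.
move=> n_gt0; rewrite -polyC_natr poly_unitE size_polyC coefC /=.
by rewrite pnatr_eq0 -lt0n n_gt0 unitfE pnatr_eq0 -lt0n n_gt0.
Qed.

Lemma euler_egfE : fps_egf euler_poly =1 euler_gf.
Proof.
by move=> n; rewrite /fps_egf /euler_poly mulrC mulKr // unit_polyn ?fact_gt0.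
Qed.

Lemma euler_egfP :
  fps_mul (fps_egf euler_poly) (fps_add (fps_exp 1) (@fps_one _))
  =1 fps_scale 2%:R (fps_exp 'X).
Proof.
move=> n; rewrite (eq_fps_mul euler_egfE (frefl _)) fps_divK //.
rewrite /fps_add /fps_exp /fps_one fact0 expr0 divr1; exact: (@unit_polyn 2).
Qed.

End Polynomials.

(* Main.v *)
Require Import Defs.
From HB Require Import structures.
From mathcomp Require Import all_boot all_order all_algebra.
From mathcomp Require Import reals complex.
From mathcomp Require Import ring.

Import Order.TTheory GRing.Theory Num.Theory.
Local Open Scope ring_scope.

(** Write a = 3x + s and b = 3x - s.  Then ab = 1, so the Binet formula gives
    2 C_(2j)(x) = a^(2j) + b^(2j), and d = a^2 - b^2 = 12xs.  Let L be the
    umbral functional L(X^k) = E_k(x).  The generating function of the Euler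
    polynomials says that L(p(X + 1) + p(X)) = 2 p(x) for every polynomial p;
    the theorem is the case p = (b^2 + d X)^n, for which
    p(X + 1) = (a^2 + d X)^n. *)

Lemma coef_affine_exp (A : comNzRingType) (a d : A) (n k : nat) :
  ((a%:P + d *: 'X) ^+ n)`_k = 'C(n, k)%:R * a ^+ (n - k) * d ^+ k.
Proof.
rewrite exprDn coef_sum.
under eq_bigr => i _ do
  rewrite coefMn exprZn -polyC_exp coefCM coefZ coefXn.
have [lt_nk|le_kn] := ltnP n k.
  rewrite bin_small // !mul0r big1 // => i _.
  by rewrite gtn_eqF ?mulr0 ?mul0rn // (leq_trans (ltn_ord i)).
rewrite (bigD1 (Ordinal (le_kn : (k < n.+1)%N))) //= eqxx mulr1 big1 ?addr0.
  by rewrite mulr_natl mulrnAl.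
by move=> i ne_ik; rewrite eq_sym (negPf ne_ik : (i == k :> nat) = false)
  !mulr0 mul0rn.
Qed.

(** Both sides are linear in [p], and for [p = 'X^k] the equality is the hypothesis, by the binomial
    expansion of [('X + 1) ^+ k]. *)
Lemma umbral_shift (A : comNzRingType) (e : nat -> A) (x : A) :
    (forall k, \sum_(i < k.+1) 'C(k, i)%:R * e i + e k = 2%:R * x ^+ k) ->
  forall (N : nat) (p : {poly A}), (size p <= N)%N ->
  \sum_(i < N) (p \Po ('X + 1) + p)`_i * e i = 2%:R * p.[x].
Proof.
move=> eP N p le_pN.
under eq_bigr => i _ do rewrite coefD mulrDl coef_comp_poly mulr_suml.
rewrite big_split /= exchange_big horner_coef mulr_sumr /=.
have -> : \sum_(i < N) p`_i * e i = \sum_(i < size p) p`_i * e i.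
  rewrite (big_ord_widen N (fun i => p`_i * e i) le_pN) [RHS]big_mkcond.
  by apply: eq_bigr => i _; case: ltnP => // /(nth_default 0) ->; rewrite mul0r.
rewrite -big_split; apply: eq_bigr => m _ /=; rewrite mulrCA -eP mulrDr.
congr (_ + _); rewrite mulr_sumr.
have le_mN : (m < N)%N := leq_trans (ltn_ord m) le_pN.
rewrite [RHS](big_ord_widen N (fun i => p`_m * ('C(m, i)%:R * e i)) le_mN).
rewrite [RHS]big_mkcond; apply: eq_bigr => i _.
have -> : 'X + 1 = 1%:P + 1 *: 'X :> {poly A} by rewrite scale1r addrC.
rewrite coef_affine_exp !expr1n !mulr1 -mulrA ltnS.
(* Indices [i > m] add nothing, since then ['C(m, i) = 0]. *)
by case: leqP => // lt_mi; rewrite bin_small // mul0r mulr0.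
Qed.

(** Compare the coefficients of z^k in E(z)(e^z + 1) = 2 e^(xz) and multiply by [k!]. *)
Lemma euler_poly_rec (F : numFieldType) (k : nat) :
  \sum_(i < k.+1) 'C(k, i)%:R * euler_poly F i + euler_poly F k
  = 2%:R * 'X ^+ k.
Proof.
have Uf m : (m`!%:R : {poly F}) \is a GRing.unit by rewrite unit_polyn ?fact_gt0.
have /(congr1 ( *%R k`!%:R)) := euler_egfP F k.
rewrite /fps_scale /fps_exp mulrCA [_ * (_ / _)]mulrC divrK // => <-.
rewrite /fps_mul /fps_add /fps_exp /fps_egf.
under [in RHS]eq_bigr => i _ do rewrite mulrDr.
rewrite big_split /= mulrDr; congr (_ + _).
  rewrite mulr_sumr; apply: eq_bigr => i _.
  have le_ik : (i <= k)%N by rewrite -ltnS.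
  rewrite expr1n -(bin_fact le_ik) !natrM mul1r.
  (* Factorials are units, so the two quotients isolated here equal 1. *)
  rewrite [RHS](_ : _ = 'C(k, i)%:R * euler_poly F i * (i`!%:R / i`!%:R)
    * ((k - i)`!%:R / (k - i)`!%:R)); first by rewrite !divrr // !mulr1.
  ring.
have := @fps_mul1 _ (fps_egf (euler_poly F)) k.
by rewrite /fps_mul /fps_egf => ->; rewrite mulrC divrK.
Qed.

(** Both 3x + s and 3x - s are roots of t^2 = 6xt - 1, so the right side obeys the recurrence of the
    left. *)
Lemma lucas_balancing_binet (F : numFieldType) (x s : F) (m : nat) :
  s ^+ 2 = 9%:R * x ^+ 2 - 1 ->
  2%:R * (lucas_balancing F m).[x] = (3%:R * x + s) ^+ m + (3%:R * x - s) ^+ m.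
Proof.
move=> s2.
elim/ltn_ind: m => -[|[|m]] IH.
- by rewrite /= hornerE mulr1 !expr0.
- rewrite [lucas_balancing _ _]/= hornerZ hornerX !expr1; ring.
rewrite [lucas_balancing _ _]/= -/(lucas_balancing F m.+1) hornerD hornerN hornerM.
rewrite hornerZ hornerX mulrBr mulrCA !IH // !exprS.
set u := _ ^+ m; set v := _ ^+ m.
have a2 : (3%:R * x + s) ^+ 2 = 6%:R * x * (3%:R * x + s) - 1.
  by rewrite sqrrD s2; ring.
have b2 : (3%:R * x - s) ^+ 2 = 6%:R * x * (3%:R * x - s) - 1.
  by rewrite sqrrB s2; ring.
rewrite !mulrA -!expr2 a2 b2; ring.
Qed.

Theorem theorem6 (R : realType) (n : nat) (x s : R[i]) :
  s ^+ 2 = 9%:R * x ^+ 2 - 1 ->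
  \sum_(k < n.+1)
     'C(n, k)%:R * (lucas_balancing R[i] (2 * (n - k))).[x]
       * (12%:R * x * s) ^+ k * (euler_poly R[i] k).[x]
  = (18%:R * x ^+ 2 - 1 + 6%:R * x * (2%:R * x - 1) * s) ^+ n.
Proof.
move=> s2; have two_neq0 : 2%:R != 0 :> R[i] by rewrite pnatr_eq0.
(* The factor 2 serves both Binet's formula on the left and [2 * p.[x]] on the right. *)
apply: (mulfI two_neq0).
set b2 : R[i] := (3%:R * x - s) ^+ 2; set d := 12%:R * x * s.
pose p := (b2%:P + d *: 'X) ^+ n.
have eP k : \sum_(i < k.+1) 'C(k, i)%:R * (euler_poly R[i] i).[x]
    + (euler_poly R[i] k).[x] = 2%:R * x ^+ k.
  have /(congr1 (fun q => q.[x])) := euler_poly_rec R[i] k.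
  rewrite hornerD horner_sum -!polyC_natr !hornerE => <-.
  by congr (_ + _); apply: eq_bigr => i _; rewrite -polyC_natr hornerCM.
have size_p : (size p <= n.+1)%N.
  by apply/leq_sizeP => j lt_nj; rewrite coef_affine_exp bin_small // !mul0r.
have := umbral_shift _ _ _ eP _ _ size_p.
have -> : p.[x] = (18%:R * x ^+ 2 - 1 + 6%:R * x * (2%:R * x - 1) * s) ^+ n.
  rewrite /p horner_exp hornerD hornerC hornerZ hornerX; congr (_ ^+ n).
  by rewrite /b2 /d sqrrB s2; ring.
move=> <-; rewrite mulr_sumr; apply: eq_bigr => k _.
(* The shift replaces [b2] by [b2 + d], and (3x - s)^2 + 12xs = (3x + s)^2. *)
have -> : p \Po ('X + 1) = (((3%:R * x + s) ^+ 2)%:P + d *: 'X) ^+ n.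
  rewrite /p rmorphXn /= comp_polyD comp_polyC comp_polyZ comp_polyX.
  congr (_ ^+ n); rewrite scalerDr addrCA addrC alg_polyC -polyCD.
  by congr (_%:P + _); rewrite /b2 /d; ring.
(* The k-th coefficient of p(X + 1) + p(X) is ['C(n, k) * d ^+ k] times a sum of two powers of
   exponent [2 * (n - k)], which Binet's formula evaluates. *)
rewrite coefD !coef_affine_exp -!exprM.
have := lucas_balancing_binet _ _ _ (2 * (n - k)) s2.
move: (_ ^+ (2 * _)) => u; move: (_ ^+ (2 * _)) => v C2.
rewrite -mulrDl -mulrDr -C2; ring.
Qed.
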